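(* Let $n,m$ be integers with $0\le m<n$, and suppose $\chi_n>c^2$. Let $t_1<\dots<t_n$ be the roots of $\psi_n$ in $(-1,1)$, $\Psi_n(1,t)=\int_0^1\psi_n(x)e^{-icxt}\,dx$, and $$P_{n,m}=\sum_{j=1}^n\frac{\psi_m(t_j)}{\psi_n'(t_j)}\Psi_n(1,t_j).$$ Then $c|P_{n,m}|\le\sqrt{32}\,n^2$.
   Context: For a real number $c>0$, let $F_c[\varphi](x)=\int_{-1}^1\varphi(t)e^{icxt}\,dt$ on $L^2[-1,1]$, with eigenvalues $\lambda_0,\lambda_1,\dots$ ordered so that $|\lambda_n|\ge|\lambda_{n+1}|$ and corresponding real eigenfunctions $\psi_0,\psi_1,\dots$ (prolate spheroidal wave functions) with $\|\psi_n\|_{L^2[-1,1]}=1$; $\psi_n$ has the parity of $n$ and exactly $n$ simple roots in $(-1,1)$. $\chi_0<\chi_1<\dots$ are the positive numbers such that $\psi_n$ satisfies $(1-x^2)\psi''(x)-2x\psi'(x)+(\chi_n-c^2x^2)\psi(x)=0$. *)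

(* Defs.v *)
From Stdlib Require Import Reals.
From Coquelicot Require Import Coquelicot.
Open Scope R_scope.

(* Real and imaginary parts of F_c[phi](x) = int_{-1}^1 phi(t) e^{i c x t} dt,
   for real-valued phi. *)
Definition Fc_re (c : R) (phi : R -> R) (x : R) : R :=
  RInt (fun t => phi t * cos (c * x * t)) (-1) 1.
Definition Fc_im (c : R) (phi : R -> R) (x : R) : R :=
  RInt (fun t => phi t * sin (c * x * t)) (-1) 1.

(* The defining properties (from the standing context) of the prolate
   spheroidal wave functions psi_n with bandwidth c, eigenvalues
   lambda_n = lam_re n + i lam_im n of F_c, and ODE eigenvalues chi_n. *)
Record PSWF_system (c : R) (lam_re lam_im : nat -> R)
    (psi : nat -> R -> R) (chi : nat -> R) : Prop := {
  pswf_cont : forall n x, -1 <= x <= 1 -> continuous (psi n) x;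
  pswf_norm : forall n, RInt (fun x => psi n x ^ 2) (-1) 1 = 1;
  pswf_eig : forall n x, -1 <= x <= 1 ->
    Fc_re c (psi n) x = lam_re n * psi n x /\
    Fc_im c (psi n) x = lam_im n * psi n x;
  pswf_order : forall n,
    lam_re (S n) ^ 2 + lam_im (S n) ^ 2 <= lam_re n ^ 2 + lam_im n ^ 2;
  pswf_parity : forall n x, psi n (- x) = (-1) ^ n * psi n x;
  pswf_roots : forall n, exists r : nat -> R,
    (forall j, (1 <= j < n)%nat -> r j < r (S j)) /\
    (forall j, (1 <= j <= n)%nat -> -1 < r j < 1 /\ psi n (r j) = 0) /\
    (forall x, -1 < x < 1 -> psi n x = 0 ->
       exists j, (1 <= j <= n)%nat /\ x = r j);
  pswf_simple : forall n x, -1 < x < 1 -> psi n x = 0 ->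
    Derive (psi n) x <> 0;
  pswf_ode : forall n x, -1 < x < 1 ->
    ex_derive (psi n) x /\ ex_derive (Derive (psi n)) x /\
    (1 - x ^ 2) * Derive (Derive (psi n)) x - 2 * x * Derive (psi n) x
      + (chi n - c ^ 2 * x ^ 2) * psi n x = 0;
  pswf_chi_pos : forall n, 0 < chi n;
  pswf_chi_incr : forall n, chi n < chi (S n)
}.

(* Psi_n(1,t) = int_0^1 psi_n(x) e^{-i c x t} dx, real and imaginary parts. *)
Definition Psi1_re (c : R) (phi : R -> R) (t : R) : R :=
  RInt (fun x => phi x * cos (c * x * t)) 0 1.
Definition Psi1_im (c : R) (phi : R -> R) (t : R) : R :=
  - RInt (fun x => phi x * sin (c * x * t)) 0 1.

Definition P_re (c : R) (psi : nat -> R -> R) (n m : nat) (t : nat -> R) : R :=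
  sum_n_m (fun j => psi m (t j) / Derive (psi n) (t j) * Psi1_re c (psi n) (t j)) 1 n.
Definition P_im (c : R) (psi : nat -> R -> R) (n m : nat) (t : nat -> R) : R :=
  sum_n_m (fun j => psi m (t j) / Derive (psi n) (t j) * Psi1_im c (psi n) (t j)) 1 n.

(* Main.v *)
Require Import Defs.
From Stdlib Require Import Reals Lra Lia Classical_Prop.
From Coquelicot Require Import Coquelicot.
Open Scope R_scope.

(** Write [p = 1 - x^2], [q = chi - c^2 x^2], [f = psi_n].  When [chi > c^2],
    on [[0, 1)] the amplitude [f^2 + (p / q) f'^2] is nondecreasing and the
    energy [E = p q f^2 + (p f')^2] is nonincreasing.  At a root [t] the former
    gives [f'(t)^2 >= E 0] and the latter [(p f')(t)^2 >= 8/27 f(1)^2], while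
    [int_0^1 f^2 = 1/2] forces [8 f(1)^2 E 0 >= chi]; multiplying,
    [27 (p f'^2)(t)^2 >= chi_n].  On the other side, integrating [(p psi_m^2)']
    gives [p psi_m^2 <= 1 + sqrt chi_n], so the weight [p] cancels in
    [psi_m(t)^2 / f'(t)^2].  Since Sturm comparison for [sqrt p * f] gives
    [chi_n + 1 <= (pi (n + 1) / 2)^2], hence [c <= sqrt chi_n <= 3 n], this ratio
    is at most [(8 n / c)^2], and [|Psi_n(1, t)| <= 1 / sqrt 2] by
    Cauchy-Schwarz. *)

(** * Calculus on an interval *)

Lemma mean_value (g dg : R -> R) (a b : R) :
  a < b ->
  (forall x, a <= x <= b -> continuous g x) ->
  (forall x, a < x < b -> is_derive g x (dg x)) ->
  exists x, a < x < b /\ g b - g a = dg x * (b - a).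
Proof.
  intros Hab Hcont Hder.
  assert (Hg : forall x, a < x < b -> derivable_pt_lim g x (dg x))
    by (intros x Hx; now apply is_derive_Reals, Hder).
  destruct (MVT g id a b (fun x Hx => exist _ (dg x) (Hg x Hx))
    (fun x _ => derivable_pt_id x) Hab) as [x [Hx E]].
  - intros x Hx. now apply continuity_pt_filterlim, Hcont.
  - intros x _. apply derivable_continuous_pt, derivable_pt_id.
  - exists x. split; [assumption|].
    rewrite derive_pt_id in E. simpl in E. unfold id in E. lra.
Qed.

Lemma nonneg_derive_le (g dg : R -> R) (a b : R) :
  a <= b ->
  (forall x, a <= x <= b -> is_derive g x (dg x)) ->
  (forall x, a <= x <= b -> 0 <= dg x) ->
  g a <= g b.
Proof.
  intros Hab Hd Hpos. destruct (Req_dec a b) as [->|Hne]; [lra|].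
  destruct (mean_value g dg a b) as [x [Hx E]].
  - lra.
  - intros x Hx. apply (ex_derive_continuous g). eexists. apply Hd, Hx.
  - intros x Hx. apply Hd. lra.
  - assert (0 <= dg x * (b - a)) by (apply Rmult_le_pos; [apply Hpos|]; lra).
    lra.
Qed.

Lemma continuous_ball (g : R -> R) (x eps : R) :
  continuous g x -> 0 < eps ->
  exists d, 0 < d /\ forall y, Rabs (y - x) < d -> Rabs (g y - g x) < eps.
Proof.
  intros Hg Heps.
  destruct (Hg _ (locally_ball (g x) (mkposreal eps Heps))) as [d Hd].
  exists d. split; [apply cond_pos | exact Hd].
Qed.

Lemma continuous_ge_of_interior (g : R -> R) (a b x K : R) :
  a < b -> a <= x <= b -> continuous g x ->
  (forall y, a < y < b -> K <= g y) -> K <= g x.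
Proof.
  intros Hab Hx Hg Hle. apply Rnot_lt_le; intros Hlt.
  destruct (continuous_ball g x (K - g x) Hg ltac:(lra)) as [d [Hd Hball]].
  set (tau := Rmin 1 (d / (b - a))).
  assert (Hquot : 0 < d / (b - a)) by (apply Rdiv_lt_0_compat; lra).
  assert (Htau : 0 < tau <= 1)
    by (split; [apply Rmin_glb_lt; lra | apply Rmin_l]).
  assert (Htaud : tau * (b - a) <= d).
  { apply Rle_trans with (d / (b - a) * (b - a)).
    - apply Rmult_le_compat_r; [lra | apply Rmin_r].
    - apply Req_le. field. lra. }
  set (y := x + tau * ((a + b) / 2 - x)).
  assert (Hy : a < y < b) by (unfold y; split; nra).
  assert (Hyx : Rabs (y - x) < d) by (apply Rabs_def1; unfold y; nra).
  assert (Hclose := Rabs_def2 _ _ (Hball y Hyx)).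
  assert (HK := Hle y Hy). lra.
Qed.

Lemma continuous_sqr (f : R -> R) (x : R) :
  continuous f x -> continuous (fun y => f y ^ 2) x.
Proof.
  intros Hf. apply (continuous_comp f (fun u => u ^ 2)); [assumption|].
  apply (ex_derive_continuous (fun u => u ^ 2)). auto_derive. easy.
Qed.

Lemma continuous_nonzero_same_sign (f : R -> R) (a b u v : R) :
  (forall x, a < x < b -> continuous f x) ->
  (forall x, a < x < b -> f x <> 0) ->
  a < u < b -> a < v < b -> 0 < f u * f v.
Proof.
  intros Hf Hnz Hu Hv. apply Rnot_le_lt; intros Hle.
  set (path := fun s => u + s * (v - u)).
  assert (Hpath : forall s, 0 <= s <= 1 -> a < path s < b)
    by (intros s Hs; unfold path; destruct (Rle_lt_dec u v); split; nra).
  assert (Hfu := Hnz u Hu). assert (Hfv := Hnz v Hv).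
  destruct (Ranalysis5.IVT_interv (fun s => f (path s) * f v) 0 1) as [s [Hs E]].
  - intros s Hs. apply continuity_pt_filterlim.
    apply (continuous_mult (fun s => f (path s)) (fun _ => f v));
      [|apply continuous_const].
    apply (continuous_comp path f); [|now apply Hf, Hpath].
    apply (ex_derive_continuous path). unfold path. auto_derive. easy.
  - lra.
  - replace (path 0) with u by (unfold path; ring).
    assert (f u * f v <> 0) by now apply Rmult_integral_contrapositive. lra.
  - replace (path 1) with v by (unfold path; ring).
    apply Rsqr_pos_lt, Hfv.
  - apply Rmult_integral in E. destruct E as [E|E]; [|easy].
    now apply (Hnz (path s) (Hpath s Hs)).
Qed.

(* If [(b - x) f'(x) >= eps] throughout, then [f] would increase by at least
   [eps / 2] across every [[b - 2 u, b - u]]. *)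
Lemma exists_scaled_Derive_lt (f : R -> R) (a b eps : R) :
  a < b -> continuous f b -> (forall x, a < x < b -> ex_derive f x) -> 0 < eps ->
  exists x, a < x < b /\ (b - x) * Derive f x < eps.
Proof.
  intros Hab Hcont Hder Heps.
  destruct (continuous_ball f b (eps / 4) Hcont ltac:(lra)) as [d [Hd Hball]].
  set (u := Rmin d (b - a) / 4).
  assert (Hmin : 0 < Rmin d (b - a)) by (apply Rmin_glb_lt; lra).
  assert (Hu : 0 < u) by (unfold u; lra).
  assert (Hud : 4 * u <= d) by (unfold u; assert (Hl := Rmin_l d (b - a)); lra).
  assert (Hua : 4 * u <= b - a) by (unfold u; assert (Hr := Rmin_r d (b - a)); lra).
  destruct (mean_value f (Derive f) (b - 2 * u) (b - u)) as [x [Hx E]].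
  - lra.
  - intros x Hx. apply (ex_derive_continuous f), Hder. lra.
  - intros x Hx. apply Derive_correct, Hder. lra.
  - exists x. split; [lra|].
    assert (Hright : Rabs (f (b - u) - f b) < eps / 4)
      by (apply Hball, Rabs_def1; lra).
    assert (Hleft : Rabs (f (b - 2 * u) - f b) < eps / 4)
      by (apply Hball, Rabs_def1; lra).
    apply Rabs_def2 in Hright. apply Rabs_def2 in Hleft.
    destruct (Rle_lt_dec (Derive f x) 0); nra.
Qed.

(** * Sturm comparison *)

(* Otherwise the Wronskian of [v] and [sin (k (x - a))] would be strictly
   increasing, although it is nonnegative at [a] and nonpositive at [a + PI / k]. *)
Lemma sturm_not_pos (v dv W : R -> R) (k a : R) :
  0 < k ->
  (forall x, a <= x <= a + PI / k -> is_derive v x (dv x)) ->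
  (forall x, a <= x <= a + PI / k -> is_derive dv x (- (W x * v x))) ->
  (forall x, a < x < a + PI / k -> k ^ 2 < W x) ->
  ~ (forall x, a < x < a + PI / k -> 0 < v x).
Proof.
  intros Hk Hv Hdv HW Hpos.
  assert (Hpi : 0 < PI / k) by (apply Rdiv_lt_0_compat; [apply PI_RGT_0 | easy]).
  set (b := a + PI / k) in *.
  assert (Hab : a < b) by (unfold b; lra).
  assert (Hkb : k * (b - a) = PI) by (unfold b; field; lra).
  set (w := fun x => sin (k * (x - a))).
  set (wronskian := fun x => v x * (k * cos (k * (x - a))) - dv x * w x).
  assert (Hder : forall x, a <= x <= b ->
    is_derive wronskian x ((W x - k ^ 2) * v x * w x)).
  { intros x Hx. assert (Hvx := Hv x Hx). assert (Hdvx := Hdv x Hx).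
    unfold wronskian, w. auto_derive; [repeat split; eexists; eassumption|].
    change (fun y => v y) with v. change (fun y => dv y) with dv.
    rewrite (is_derive_unique _ _ _ Hvx), (is_derive_unique _ _ _ Hdvx).
    unfold Rminus. ring. }
  assert (Hend : forall x, a <= x <= b -> 0 <= v x).
  { intros x Hx. apply continuous_ge_of_interior with a b; [lra | easy | |].
    - apply (ex_derive_continuous v). exists (dv x). now apply Hv.
    - intros y Hy. now apply Rlt_le, Hpos. }
  assert (Hwa : 0 <= wronskian a).
  { unfold wronskian, w. rewrite Rminus_diag, Rmult_0_r, sin_0, cos_0.
    assert (0 <= v a) by (apply Hend; lra). nra. }
  assert (Hwb : wronskian b <= 0).
  { unfold wronskian, w. rewrite Hkb, sin_PI, cos_PI.
    assert (0 <= v b) by (apply Hend; lra). nra. }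
  destruct (mean_value wronskian (fun x => (W x - k ^ 2) * v x * w x) a b Hab)
    as [xi [Hxi E]].
  { intros x Hx. apply (ex_derive_continuous wronskian). eexists. now apply Hder. }
  { intros x Hx. apply Hder. lra. }
  assert (0 < (W xi - k ^ 2) * v xi * w xi).
  { assert (HWxi := HW xi Hxi).
    repeat apply Rmult_lt_0_compat; [lra | now apply Hpos |].
    unfold w. apply sin_gt_0; nra. }
  nra.
Qed.

Lemma sturm_zero (v dv W : R -> R) (k a : R) :
  0 < k ->
  (forall x, a <= x <= a + PI / k -> is_derive v x (dv x)) ->
  (forall x, a <= x <= a + PI / k -> is_derive dv x (- (W x * v x))) ->
  (forall x, a < x < a + PI / k -> k ^ 2 < W x) ->
  exists x, a < x < a + PI / k /\ v x = 0.
Proof.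
  intros Hk Hv Hdv HW. apply NNPP; intros Hno.
  assert (Hpi : 0 < PI / k) by (apply Rdiv_lt_0_compat; [apply PI_RGT_0 | easy]).
  set (m := a + PI / k / 2).
  apply (sturm_not_pos (fun x => v m * v x) (fun x => v m * dv x) W k a);
    try easy.
  - intros x Hx. now apply (is_derive_scal v), Hv.
  - intros x Hx. replace (- (W x * (v m * v x))) with (v m * - (W x * v x)) by ring.
    now apply (is_derive_scal dv), Hdv.
  - intros x Hx. apply continuous_nonzero_same_sign with a (a + PI / k); try easy.
    + intros y Hy. apply (ex_derive_continuous v). exists (dv y). apply Hv; lra.
    + intros y Hy E. apply Hno. now exists y.
    + unfold m; lra.
Qed.

Lemma increasing_steps_le (t : nat -> R) (n i j : nat) :
  (forall j, (1 <= j < n)%nat -> t j < t (S j)) ->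
  (1 <= i <= j)%nat -> (j <= n)%nat -> t i <= t j.
Proof.
  intros Hinc [Hi Hij]. induction Hij as [|j Hij IH]; intros Hj; [lra|].
  assert (Hj_lt := Hinc j ltac:(lia)). specialize (IH ltac:(lia)). lra.
Qed.

Lemma length_le_of_hit_windows (t : nat -> R) (n : nat) (l r h : R) :
  0 < h ->
  (forall j, (1 <= j < n)%nat -> t j < t (S j)) ->
  (forall a, l < a -> a + h < r ->
     exists j, (1 <= j <= n)%nat /\ a < t j < a + h) ->
  r - l <= (INR n + 1) * h.
Proof.
  intros Hh Hinc Hhit. apply Rnot_lt_le; intros Hlt.
  set (a := fun i => l + (r - l - (INR n + 1) * h) / 2 + INR i * h).
  assert (Hwindow : forall i, (i <= n)%nat ->
    exists j, (1 <= j <= n)%nat /\ a i < t j < a i + h).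
  { intros i Hi. assert (Hin := le_INR _ _ Hi). assert (Hi0 := pos_INR i).
    apply Hhit; unfold a; nra. }
  assert (Hbelow : forall i, (i <= n)%nat ->
    forall j, (1 <= j <= i)%nat -> t j < a i).
  { induction i as [|i IH]; intros Hi j Hj; [lia|].
    assert (E : a (S i) = a i + h) by (unfold a; rewrite S_INR; ring).
    destruct (Hwindow i ltac:(lia)) as [k [Hk Htk]].
    assert (Hik : (i < k)%nat).
    { apply Nat.nle_gt; intros Hle.
      specialize (IH ltac:(lia) k ltac:(lia)). lra. }
    assert (Hjk := increasing_steps_le t n j k Hinc ltac:(lia) ltac:(lia)).
    lra. }
  destruct (Hwindow n (le_n n)) as [j [Hj Htj]].
  specialize (Hbelow n (le_n n) j Hj). lra.
Qed.

Lemma PI_le_22_7 : PI <= 22 / 7.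
Proof.
  destruct (Machin.PI_2_3_7_ineq 1) as [_ Hpi].
  unfold tg_alt, Machin.PI_2_3_7_tg, Ratan_seq in Hpi. simpl in Hpi. lra.
Qed.

(** * Even and odd functions *)

Definition parity (s : R) (f : R -> R) : Prop :=
  s ^ 2 = 1 /\ forall x, f (- x) = s * f x.

Lemma parity_sqr_opp (s : R) (f : R -> R) (x : R) :
  parity s f -> f (- x) ^ 2 = f x ^ 2.
Proof. intros [Hs Hf]. rewrite Hf, Rpow_mult_distr, Hs. ring. Qed.

Lemma parity_Derive_opp (s : R) (f : R -> R) (x : R) :
  parity s f -> ex_derive f (- x) -> - Derive f (- x) = s * Derive f x.
Proof.
  intros [_ Hf] Hd. rewrite <- Derive_scal, <- (Derive_ext _ _ x Hf).
  symmetry. apply is_derive_unique. auto_derive; [auto|].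
  change (fun y => f y) with f. ring.
Qed.

Lemma parity_Derive_sqr_opp (s : R) (f : R -> R) (x : R) :
  parity s f -> ex_derive f (- x) -> Derive f (- x) ^ 2 = Derive f x ^ 2.
Proof.
  intros Hp Hd. assert (E := parity_Derive_opp s f x Hp Hd).
  replace (Derive f (- x)) with (- (s * Derive f x)) by lra.
  replace ((- (s * Derive f x)) ^ 2) with (s ^ 2 * Derive f x ^ 2) by ring.
  rewrite (proj1 Hp). ring.
Qed.

Lemma parity_mul_Derive_0 (s : R) (f : R -> R) :
  parity s f -> ex_derive f 0 -> Derive f 0 * f 0 = 0.
Proof.
  intros Hp Hd. assert (Hf := proj2 Hp 0).
  assert (E := parity_Derive_opp s f 0 Hp). rewrite Ropp_0 in *.
  specialize (E Hd).
  enough (Derive f 0 * f 0 = - (Derive f 0 * f 0)) by lra.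
  rewrite Hf at 1.
  replace (Derive f 0 * (s * f 0)) with (s * Derive f 0 * f 0) by ring.
  rewrite <- E. ring.
Qed.

Lemma RInt_even (g : R -> R) (a : R) :
  (forall x, g (- x) = g x) -> ex_RInt g (- a) 0 -> ex_RInt g 0 a ->
  RInt g (- a) a = 2 * RInt g 0 a.
Proof.
  intros Hg Hl Hr. rewrite <- (RInt_Chasles g (- a) 0 a Hl Hr).
  assert (E : RInt g (- a) 0 = RInt g 0 a).
  { apply is_RInt_unique.
    assert (Hrefl := is_RInt_swap _ _ _ _ (RInt_correct g 0 a Hr)).
    rewrite <- (Ropp_involutive a), <- Ropp_0 in Hrefl at 1.
    apply is_RInt_comp_opp, is_RInt_opp in Hrefl. rewrite opp_opp in Hrefl.
    revert Hrefl. apply is_RInt_ext. intros x _. rewrite opp_opp. apply Hg. }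
  rewrite E. unfold plus; simpl; ring.
Qed.

(** * The prolate equation *)

Definition potential (c chi x : R) : R := chi - c ^ 2 * x ^ 2.

Record prolate (c chi : R) (f : R -> R) : Prop := {
  prolate_cont : forall x, -1 <= x <= 1 -> continuous f x;
  prolate_ode : forall x, -1 < x < 1 ->
    ex_derive f x /\ ex_derive (Derive f) x /\
    (1 - x ^ 2) * Derive (Derive f) x - 2 * x * Derive f x
      + potential c chi x * f x = 0
}.

Definition endpoint_deviation (c chi x : R) : R :=
  potential c chi x * (1 - x) / (1 + x).

Definition flux (f : R -> R) (x : R) : R := (1 - x ^ 2) * Derive f x.

Definition amplitude (c chi : R) (f : R -> R) (x : R) : R :=
  f x ^ 2 + flux f x ^ 2 / ((1 - x ^ 2) * potential c chi x).

Definition energy (c chi : R) (f : R -> R) (x : R) : R :=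
  (1 - x ^ 2) * potential c chi x * f x ^ 2 + flux f x ^ 2.

Definition mass (f : R -> R) (x : R) : R := RInt (fun y => f y ^ 2) 0 x.

Lemma mass_0 (f : R -> R) : mass f 0 = 0.
Proof. apply (RInt_point 0 (fun y => f y ^ 2)). Qed.

Lemma flux_le (f dflux : R -> R) (x B : R) :
  -1 < x < 1 -> 0 <= B -> continuous f 1 ->
  (forall y, x <= y < 1 -> ex_derive f y) ->
  (forall y, x <= y < 1 -> is_derive (flux f) y (dflux y)) ->
  (forall y, x <= y < 1 -> - B <= dflux y) ->
  flux f x <= B * (1 - x).
Proof.
  intros Hx HB Hcont Hf Hflux Hbound. apply Rnot_lt_le; intros Hlt.
  set (eps := flux f x - B * (1 - x)).
  destruct (exists_scaled_Derive_lt f x 1 (eps / 2)) as [y [Hy Hlt_y]];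
    [lra | assumption | intros; apply Hf; lra | unfold eps; lra |].
  assert (Hxy : flux f x + B * x <= flux f y + B * y).
  { apply (nonneg_derive_le (fun z => flux f z + B * z) (fun z => dflux z + B));
      [lra| |]; intros z Hz.
    - apply (is_derive_plus (flux f) (fun z => B * z)); [apply Hflux; lra|].
      auto_derive; [easy | ring].
    - assert (Hz_ge := Hbound z ltac:(lra)). lra. }
  assert (Heps : eps <= flux f y).
  { assert (0 <= B * (1 - y)) by (apply Rmult_le_pos; lra). unfold eps. lra. }
  unfold flux in Heps.
  replace ((1 - y ^ 2) * Derive f y) with ((1 + y) * ((1 - y) * Derive f y))
    in Heps by ring.
  assert (0 < eps) by (unfold eps; lra). nra.
Qed.

Lemma flux_opp (f : R -> R) (x : R) : flux (fun y => - f y) x = - flux f x.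
Proof. unfold flux. rewrite Derive_opp. ring. Qed.

Lemma flux_Rabs_le (f dflux : R -> R) (x B : R) :
  -1 < x < 1 -> continuous f 1 ->
  (forall y, x <= y < 1 -> ex_derive f y) ->
  (forall y, x <= y < 1 -> is_derive (flux f) y (dflux y)) ->
  (forall y, x <= y < 1 -> Rabs (dflux y) <= B) ->
  Rabs (flux f x) <= B * (1 - x).
Proof.
  intros Hx Hcont Hf Hflux Hbound.
  assert (HB : 0 <= B) by (apply Rle_trans with (2 := Hbound x ltac:(lra)), Rabs_pos).
  assert (Hbound' : forall y, x <= y < 1 -> - B <= dflux y <= B)
    by (intros y Hy; now apply Rabs_le_between, Hbound).
  apply Rabs_le_between. split.
  - enough (- flux f x <= B * (1 - x)) by lra. rewrite <- flux_opp.
    apply flux_le with (fun y => - dflux y); try assumption.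
    + now apply (continuous_opp f).
    + intros y Hy. now apply (ex_derive_opp f), Hf.
    + intros y Hy. apply is_derive_ext with (fun z => - flux f z);
        [intros; now rewrite flux_opp | now apply (is_derive_opp (flux f)), Hflux].
    + intros y Hy. specialize (Hbound' y Hy). lra.
  - apply flux_le with dflux; try assumption. intros y Hy. now apply Hbound'.
Qed.

Section Prolate.

Context {c chi : R} {f : R -> R} (Hf : prolate c chi f).

Lemma prolate_is_derive (x : R) : -1 < x < 1 -> is_derive f x (Derive f x).
Proof. intros Hx. apply Derive_correct, (prolate_ode _ _ _ Hf x Hx). Qed.

Lemma is_derive_flux (x : R) :
  -1 < x < 1 -> is_derive (flux f) x (- (potential c chi x * f x)).
Proof.
  intros Hx. destruct (prolate_ode _ _ _ Hf x Hx) as [_ [Hd E]].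
  replace (- (potential c chi x * f x))
    with (- (2 * x) * Derive f x + (1 - x ^ 2) * Derive (Derive f) x) by lra.
  apply (is_derive_mult (fun y => 1 - y ^ 2) (Derive f)).
  - auto_derive; [easy | ring].
  - now apply Derive_correct.
  - intros; apply Rmult_comm.
Qed.

Lemma is_derive_energy (x : R) :
  -1 < x < 1 ->
  is_derive (energy c chi f) x
    (- (2 * x * (potential c chi x + c ^ 2 * (1 - x ^ 2)) * f x ^ 2)).
Proof.
  intros Hx. assert (Hdf := prolate_is_derive x Hx).
  assert (Hdflux := is_derive_flux x Hx).
  unfold energy, potential in *.
  auto_derive; [repeat split; eexists; eassumption|].
  change (fun y => f y) with f. change (fun y => flux f y) with (flux f).
  rewrite (is_derive_unique _ _ _ Hdflux). unfold flux. ring.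
Qed.

Lemma is_derive_amplitude (x : R) :
  -1 < x < 1 -> potential c chi x <> 0 ->
  is_derive (amplitude c chi f) x
    (2 * x * (potential c chi x + c ^ 2 * (1 - x ^ 2))
      / potential c chi x ^ 2 * Derive f x ^ 2).
Proof.
  intros Hx Hq. assert (Hp : 1 - x ^ 2 <> 0) by nra.
  assert (Hdf := prolate_is_derive x Hx).
  assert (Hdflux := is_derive_flux x Hx).
  unfold amplitude, potential in *. auto_derive.
  - repeat split; try (eexists; eassumption).
    apply Rmult_integral_contrapositive; split; simpl in *; lra.
  - change (fun y => f y) with f. change (fun y => flux f y) with (flux f).
    rewrite (is_derive_unique _ _ _ Hdflux). unfold flux. field.
    simpl in *; split; lra.
Qed.

Lemma is_derive_mass (x : R) : -1 < x < 1 -> is_derive (mass f) x (f x ^ 2).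
Proof.
  intros Hx. apply (is_derive_RInt (fun y => f y ^ 2) _ 0).
  - assert (Hd : 0 < 1 - Rabs x) by (assert (Rabs x < 1) by (apply Rabs_def1; lra); lra).
    exists (mkposreal _ Hd). intros b Hb. change (Rabs (b - x) < 1 - Rabs x) in Hb.
    assert (Hb1 : Rabs b < 1).
    { replace b with (b - x + x) by ring.
      apply Rle_lt_trans with (1 := Rabs_triang _ _). lra. }
    apply Rabs_def2 in Hb1.
    apply (RInt_correct (fun y => f y ^ 2)), (ex_RInt_continuous (fun y => f y ^ 2)).
    intros z Hz. apply continuous_sqr, (prolate_cont _ _ _ Hf).
    revert Hz. unfold Rmin, Rmax. destruct (Rle_dec 0 b); lra.
  - apply continuous_sqr, (prolate_cont _ _ _ Hf). lra.
Qed.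

Lemma prolate_sqr_integrable (a b : R) :
  -1 <= a -> a <= b -> b <= 1 -> ex_RInt (fun y => f y ^ 2) a b.
Proof.
  intros Ha Hab Hb. apply (ex_RInt_continuous (fun y => f y ^ 2)). intros z Hz.
  rewrite Rmin_left, Rmax_right in Hz by lra.
  apply continuous_sqr, (prolate_cont _ _ _ Hf). lra.
Qed.

Lemma mass_Chasles (x : R) :
  0 <= x <= 1 -> mass f 1 = mass f x + RInt (fun y => f y ^ 2) x 1.
Proof.
  intros Hx. symmetry.
  apply (RInt_Chasles (fun y => f y ^ 2)); apply prolate_sqr_integrable; lra.
Qed.

Lemma mass_nondecreasing (x : R) : 0 <= x <= 1 -> mass f x <= mass f 1.
Proof.
  intros Hx. rewrite (mass_Chasles x Hx).
  rewrite <- (Rplus_0_r (mass f x)) at 1. apply Rplus_le_compat_l.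
  apply RInt_ge_0; [lra | apply prolate_sqr_integrable; lra |].
  intros. apply pow2_ge_0.
Qed.

Lemma prolate_flux_Rabs_le (x B : R) :
  -1 < x < 1 ->
  (forall y, x <= y < 1 -> Rabs (potential c chi y * f y) <= B) ->
  Rabs (flux f x) <= B * (1 - x).
Proof.
  intros Hx HB. apply flux_Rabs_le with (fun y => - (potential c chi y * f y)).
  - assumption.
  - apply (prolate_cont _ _ _ Hf). lra.
  - intros y Hy. eexists. apply prolate_is_derive. lra.
  - intros y Hy. apply is_derive_flux. lra.
  - intros y Hy. rewrite Rabs_Ropp. now apply HB.
Qed.

Lemma prolate_Derive_Rabs_le (x B : R) :
  -1 < x < 1 ->
  (forall y, x <= y < 1 -> Rabs (potential c chi y * f y) <= B) ->
  (1 + x) * Rabs (Derive f x) <= B.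
Proof.
  intros Hx HB. assert (Hflux := prolate_flux_Rabs_le x B Hx HB). unfold flux in Hflux.
  rewrite Rabs_mult, (Rabs_pos_eq (1 - x ^ 2)) in Hflux by nra.
  apply Rmult_le_reg_l with (1 - x); [lra|].
  replace ((1 - x) * ((1 + x) * Rabs (Derive f x)))
    with ((1 - x ^ 2) * Rabs (Derive f x)) by ring.
  lra.
Qed.

Lemma prolate_flux_vanishes :
  exists C, forall x, -1 < x < 1 -> Rabs (flux f x) <= C * (1 - x).
Proof.
  destruct (bounded_continuity (fun x => potential c chi x * f x) (-1) 1) as [C HC].
  - intros x Hx. apply (continuous_mult (potential c chi) f);
      [|now apply (prolate_cont _ _ _ Hf)].
    apply (ex_derive_continuous (potential c chi)). unfold potential. auto_derive. easy.
  - exists C. intros x Hx. apply prolate_flux_Rabs_le; [assumption|].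
    intros y Hy. apply Rlt_le, HC. lra.
Qed.

Lemma prolate_bounded : exists B, forall x, -1 <= x <= 1 -> Rabs (f x) <= B.
Proof.
  destruct (bounded_continuity f (-1) 1 (prolate_cont _ _ _ Hf)) as [B HB].
  exists B. intros x Hx. apply Rlt_le, HB, Hx.
Qed.

(** * Monotone quantities *)

Section PositivePotential.

Hypothesis Hchi : c ^ 2 < chi.

Lemma potential_pos (x : R) : -1 <= x <= 1 -> 0 < potential c chi x.
Proof.
  intros Hx. unfold potential. assert (x ^ 2 <= 1) by nra.
  assert (Hc2 := pow2_ge_0 c). nra.
Qed.

Lemma potential_ge (x : R) : chi * (1 - x ^ 2) <= potential c chi x.
Proof. unfold potential. assert (Hx2 := pow2_ge_0 x). nra. Qed.

Lemma amplitude_nondecreasing (x y : R) :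
  0 <= x <= y -> y < 1 -> amplitude c chi f x <= amplitude c chi f y.
Proof.
  intros Hxy Hy. eapply nonneg_derive_le; [apply Hxy| |]; intros z Hz;
    assert (Hq := potential_pos z ltac:(lra)).
  - apply is_derive_amplitude; lra.
  - apply Rmult_le_pos; [|apply pow2_ge_0].
    apply Rle_mult_inv_pos; [|nra]. apply Rmult_le_pos; [lra|].
    assert (0 <= c ^ 2 * (1 - z ^ 2)) by (apply Rmult_le_pos; [apply pow2_ge_0 | nra]).
    lra.
Qed.

Lemma energy_nonincreasing (x y : R) :
  0 <= x <= y -> y < 1 -> energy c chi f y <= energy c chi f x.
Proof.
  intros Hxy Hy. apply Ropp_le_cancel.
  apply (nonneg_derive_le (fun z => - energy c chi f z)
    (fun z => - - (2 * z * (potential c chi z + c ^ 2 * (1 - z ^ 2)) * f z ^ 2)));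
    [lra| |]; intros z Hz.
  - apply (is_derive_opp (energy c chi f)), is_derive_energy. lra.
  - rewrite Ropp_involutive. assert (Hq := potential_pos z ltac:(lra)).
    apply Rmult_le_pos; [|apply pow2_ge_0]. apply Rmult_le_pos; [lra|].
    assert (0 <= c ^ 2 * (1 - z ^ 2)) by (apply Rmult_le_pos; [apply pow2_ge_0 | nra]).
    lra.
Qed.

Lemma energy_nonneg (x : R) : -1 <= x <= 1 -> 0 <= energy c chi f x.
Proof.
  intros Hx. assert (Hq := potential_pos x Hx).
  apply Rplus_le_le_0_compat; [|apply pow2_ge_0].
  apply Rmult_le_pos; [|apply pow2_ge_0]. apply Rmult_le_pos; nra.
Qed.

Lemma prolate_sqr_le_endpoint (x : R) : 0 <= x <= 1 -> f x ^ 2 <= f 1 ^ 2.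
Proof.
  intros Hx. destruct (Req_dec x 1) as [->|Hx1]; [lra|].
  destruct prolate_flux_vanishes as [C HC].
  set (g := fun y => f y ^ 2 + C ^ 2 * (1 - y) / ((1 + y) * potential c chi y)).
  assert (Hq1 := potential_pos 1 ltac:(lra)).
  replace (f 1 ^ 2) with (g 1) by (unfold g; field; lra).
  apply continuous_ge_of_interior with x 1; [lra | lra | |].
  - apply (continuous_plus (fun y => f y ^ 2)).
    + apply continuous_sqr, (prolate_cont _ _ _ Hf). lra.
    + apply (ex_derive_continuous
        (fun y => C ^ 2 * (1 - y) / ((1 + y) * potential c chi y))).
      unfold potential in *. auto_derive. simpl in Hq1; nra.
  - intros y Hy. apply Rle_trans with (amplitude c chi f x).
    + assert (Hq := potential_pos x ltac:(lra)).
      assert (0 <= flux f x ^ 2 / ((1 - x ^ 2) * potential c chi x)).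
      { apply Rle_mult_inv_pos; [apply pow2_ge_0|].
        apply Rmult_lt_0_compat; nra. }
      unfold amplitude. lra.
    + apply Rle_trans with (1 := amplitude_nondecreasing x y ltac:(lra) ltac:(lra)).
      apply Rplus_le_compat_l.
      assert (Hq := potential_pos y ltac:(lra)). assert (Hp : 0 < 1 - y ^ 2) by nra.
      apply Rmult_le_reg_r with ((1 - y ^ 2) * potential c chi y);
        [now apply Rmult_lt_0_compat|].
      replace (C ^ 2 * (1 - y) / ((1 + y) * potential c chi y)
        * ((1 - y ^ 2) * potential c chi y)) with ((C * (1 - y)) ^ 2) by (field; lra).
      replace (flux f y ^ 2 / ((1 - y ^ 2) * potential c chi y)
        * ((1 - y ^ 2) * potential c chi y)) with (flux f y ^ 2) by (field; lra).
      apply pow_maj_Rabs, HC. lra.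
Qed.

Lemma prolate_endpoint_deviation (x : R) :
  0 <= x < 1 -> Rabs (f 1 - f x) <= Rabs (f 1) * endpoint_deviation c chi x.
Proof.
  intros Hx.
  destruct (mean_value f (Derive f) x 1) as [y [Hy E]].
  - lra.
  - intros z Hz. apply (prolate_cont _ _ _ Hf). lra.
  - intros z Hz. apply prolate_is_derive. lra.
  - assert (HD : (1 + y) * Rabs (Derive f y) <= potential c chi x * Rabs (f 1)).
    { apply prolate_Derive_Rabs_le; [lra|]. intros z Hz.
      assert (Hq := potential_pos z ltac:(lra)).
      rewrite Rabs_mult, (Rabs_pos_eq (potential c chi z)) by lra.
      apply Rmult_le_compat; [lra | apply Rabs_pos | |].
      - unfold potential. assert (x ^ 2 <= z ^ 2) by nra.
        assert (Hc2 := pow2_ge_0 c). nra.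
      - apply Rsqr_le_abs_0. rewrite !Rsqr_pow2. apply prolate_sqr_le_endpoint. lra. }
    rewrite E, Rabs_mult, (Rabs_pos_eq (1 - x)) by lra.
    assert (HD0 := Rabs_pos (Derive f y)).
    assert ((1 + x) * Rabs (Derive f y) <= (1 + y) * Rabs (Derive f y))
      by (apply Rmult_le_compat_r; lra).
    unfold endpoint_deviation. apply Rmult_le_reg_l with (1 + x); [lra|].
    replace ((1 + x) * (Rabs (f 1) * (potential c chi x * (1 - x) / (1 + x))))
      with (potential c chi x * Rabs (f 1) * (1 - x)) by (field; lra).
    nra.
Qed.

(** * Mass and energy *)

Lemma mass_le_energy (x : R) :
  0 <= x < 1 -> chi * mass f x <= energy c chi f 0 * (x / (1 - x ^ 2)).
Proof.
  intros Hx. set (E0 := energy c chi f 0).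
  set (gap := fun y => E0 * (y / (1 - y ^ 2)) - chi * mass f y).
  enough (gap 0 <= gap x) as Hgap.
  { unfold gap in Hgap. rewrite mass_0 in Hgap. lra. }
  apply (nonneg_derive_le gap
    (fun y => E0 * ((1 + y ^ 2) / (1 - y ^ 2) ^ 2) - chi * f y ^ 2)); [lra| |];
    intros y Hy; assert (Hp : 0 < 1 - y ^ 2) by nra.
  - apply (is_derive_minus (fun y => E0 * (y / (1 - y ^ 2)))).
    + auto_derive; [lra | field; lra].
    + apply (is_derive_scal (mass f)), is_derive_mass. lra.
  - assert (Hdecay : chi * (1 - y ^ 2) ^ 2 * f y ^ 2 <= E0).
    { apply Rle_trans with (2 := energy_nonincreasing 0 y ltac:(lra) ltac:(lra)).
      unfold energy. assert (Hflux := pow2_ge_0 (flux f y)).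
      assert (Hpf : 0 <= (1 - y ^ 2) * f y ^ 2)
        by (apply Rmult_le_pos; [lra | apply pow2_ge_0]).
      assert (Hq := Rmult_le_compat_r _ _ _ Hpf (potential_ge y)). nra. }
    assert (HE0 : 0 <= E0) by (apply energy_nonneg; lra).
    apply Rmult_le_reg_l with ((1 - y ^ 2) ^ 2); [nra|].
    replace ((1 - y ^ 2) ^ 2 * (E0 * ((1 + y ^ 2) / (1 - y ^ 2) ^ 2) - chi * f y ^ 2))
      with (E0 + E0 * y ^ 2 - chi * (1 - y ^ 2) ^ 2 * f y ^ 2) by (field; lra).
    assert (0 <= E0 * y ^ 2) by (apply Rmult_le_pos; [lra | apply pow2_ge_0]).
    lra.
Qed.

Lemma mass_tail_le (x : R) :
  0 <= x <= 1 -> mass f 1 <= mass f x + (1 - x) * f 1 ^ 2.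
Proof.
  intros Hx. rewrite (mass_Chasles x Hx). apply Rplus_le_compat_l.
  apply Rle_trans with (1 := Rle_abs _).
  apply abs_RInt_le_const; [lra | apply prolate_sqr_integrable; lra |].
  intros y Hy. rewrite Rabs_pos_eq by apply pow2_ge_0.
  apply prolate_sqr_le_endpoint. lra.
Qed.

(* The mass is split at distance [mass f 1 / (2 f(1)^2)] from the endpoint, so
   that the tail accounts for at most half of it. *)
Lemma mass_sqr_le_endpoint_energy :
  chi * mass f 1 ^ 2 <= 2 * f 1 ^ 2 * energy c chi f 0.
Proof.
  assert (Hmass0 := mass_nondecreasing 0 ltac:(lra)).
  assert (Hmass1 := mass_tail_le 0 ltac:(lra)).
  rewrite mass_0 in Hmass0, Hmass1.
  assert (HE0 := energy_nonneg 0 ltac:(lra)).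
  assert (Hmass := mass_le_energy). assert (Htail := mass_tail_le).
  set (mu := mass f 1) in *. set (M := f 1 ^ 2) in *.
  set (E0 := energy c chi f 0) in *.
  destruct (Req_dec mu 0) as [->|Hmu]; [nra|].
  set (d := mu / (2 * M)).
  assert (HdM : d * M = mu / 2) by (unfold d; field; lra).
  assert (Hd : 0 < d <= 1 / 2) by (split; nra).
  specialize (Hmass (1 - d) ltac:(lra)). specialize (Htail (1 - d) ltac:(lra)).
  assert (Hx : (1 - d) / (1 - (1 - d) ^ 2) <= M / mu).
  { replace (M / mu) with ((1 - d) / (1 - (1 - d) ^ 2) + / (2 * (2 - d))).
    - assert (0 < / (2 * (2 - d))) by (apply Rinv_0_lt_compat; lra). lra.
    - replace mu with (2 * (d * M)) by lra. field. repeat split; nra. }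
  assert (Hhalf : chi * (mu / 2) <= E0 * (M / mu)).
  { apply Rle_trans with (chi * mass f (1 - d)).
    - apply Rmult_le_compat_l; [assert (Hc2 := pow2_ge_0 c) |]; lra.
    - apply Rle_trans with (1 := Hmass). now apply Rmult_le_compat_l. }
  apply Rmult_le_compat_r with (r := 2 * mu) in Hhalf; [|lra].
  replace (E0 * (M / mu) * (2 * mu)) with (2 * M * E0) in Hhalf by (field; lra).
  lra.
Qed.

(** * Lower bound for the derivative at a root *)

Lemma endpoint_deviation_ge (x : R) :
  -1 < x <= 1 -> chi * (1 - x) ^ 2 <= endpoint_deviation c chi x.
Proof.
  intros Hx. unfold endpoint_deviation. assert (Hq := potential_ge x).
  apply Rmult_le_reg_r with (1 + x); [lra|].
  replace (potential c chi x * (1 - x) / (1 + x) * (1 + x))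
    with (potential c chi x * (1 - x)) by (field; lra).
  replace (chi * (1 - x) ^ 2 * (1 + x)) with (chi * (1 - x ^ 2) * (1 - x)) by ring.
  apply Rmult_le_compat_r; lra.
Qed.

Lemma endpoint_deviation_le (x : R) : 0 <= x <= 1 -> endpoint_deviation c chi x <= chi.
Proof.
  intros Hx. unfold endpoint_deviation.
  assert (Hq := potential_pos x ltac:(lra)).
  assert (Hcx : 0 <= c ^ 2 * x ^ 2) by (apply Rmult_le_pos; apply pow2_ge_0).
  apply Rmult_le_reg_r with (1 + x); [lra|].
  replace (potential c chi x * (1 - x) / (1 + x) * (1 + x))
    with (potential c chi x * (1 - x)) by (field; lra).
  unfold potential in *. nra.
Qed.

Lemma endpoint_deviation_attains (x theta : R) :
  0 <= x <= 1 -> 0 < theta <= endpoint_deviation c chi x ->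
  exists y, x <= y < 1 /\ endpoint_deviation c chi y = theta.
Proof.
  intros Hx Htheta.
  set (g := fun y => theta * (1 + y) - potential c chi y * (1 - y)).
  assert (Hg : forall y, 0 <= y -> g y = (theta - endpoint_deviation c chi y) * (1 + y))
    by (intros y Hy; unfold g, endpoint_deviation; field; lra).
  destruct (IVT_cor g x 1) as [y [Hy E]].
  - intros y. apply continuity_pt_filterlim, (ex_derive_continuous g).
    unfold g, potential. auto_derive. easy.
  - apply Hx.
  - replace (g 1) with (2 * theta) by (unfold g; ring). rewrite Hg by lra.
    assert (0 <= (endpoint_deviation c chi x - theta) * (1 + x) * theta)
      by (repeat apply Rmult_le_pos; lra).
    lra.
  - exists y. split.
    + destruct (Req_dec y 1) as [->|Hy1]; [unfold g in E|]; lra.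
    + rewrite Hg in E by lra. apply Rmult_integral in E. lra.
Qed.

Lemma prolate_root_deviation (t : R) :
  0 <= t < 1 -> f t = 0 -> f 1 <> 0 -> 1 <= endpoint_deviation c chi t.
Proof.
  intros Ht Hroot Hf1. assert (Hdev := prolate_endpoint_deviation t Ht).
  rewrite Hroot, Rminus_0_r in Hdev.
  apply Rmult_le_reg_l with (Rabs (f 1)); [now apply Rabs_pos_lt | lra].
Qed.

Lemma energy_ge_of_deviation (y : R) :
  0 <= y < 1 -> endpoint_deviation c chi y <= 1 ->
  (1 + y) ^ 2 * (endpoint_deviation c chi y * (1 - endpoint_deviation c chi y) ^ 2)
    * f 1 ^ 2 <= energy c chi f y.
Proof.
  intros Hy Htheta. assert (Hdev := prolate_endpoint_deviation y Hy).
  assert (Epq : (1 - y ^ 2) * potential c chi y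
    = (1 + y) ^ 2 * endpoint_deviation c chi y)
    by (unfold endpoint_deviation; field; lra).
  assert (Hq := potential_pos y ltac:(lra)).
  assert (Hpq : 0 <= (1 - y ^ 2) * potential c chi y) by (apply Rmult_le_pos; nra).
  unfold energy. rewrite Epq in *.
  set (theta := endpoint_deviation c chi y) in *.
  assert (Hfy : (1 - theta) ^ 2 * f 1 ^ 2 <= f y ^ 2).
  { assert (Htri := Rabs_triang_inv (f 1) (f 1 - f y)).
    replace (f 1 - (f 1 - f y)) with (f y) in Htri by ring.
    rewrite <- (pow2_abs (f 1)), <- (pow2_abs (f y)), <- Rpow_mult_distr.
    apply pow_incr. assert (Hf1 := Rabs_pos (f 1)). split; nra. }
  apply Rmult_le_compat_l with (1 := Hpq) in Hfy.
  assert (Hflux := pow2_ge_0 (flux f y)). lra.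
Qed.

(* The deviation [theta = 1 / 3] maximises [theta (1 - theta) ^ 2]. *)
Lemma prolate_root_flux_ge (t : R) :
  0 <= t < 1 -> f t = 0 -> 8 / 27 * f 1 ^ 2 <= flux f t ^ 2.
Proof.
  intros Ht Hroot. assert (Hf12 := pow2_ge_0 (f 1)).
  destruct (Req_dec (f 1) 0) as [->|Hf1]; [assert (Hflux := pow2_ge_0 (flux f t)); lra|].
  assert (Hdev := prolate_root_deviation t Ht Hroot Hf1).
  destruct (endpoint_deviation_attains t (1 / 3) ltac:(lra) ltac:(lra)) as [y [Hy Ey]].
  assert (Hnear : 3 * (1 - y) ^ 2 <= 1).
  { assert (Hlow := endpoint_deviation_ge y ltac:(lra)).
    assert (Hup := endpoint_deviation_le t ltac:(lra)).
    assert (Hy2 := pow2_ge_0 (1 - y)). nra. }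
  replace (flux f t ^ 2) with (energy c chi f t) by (unfold energy; rewrite Hroot; ring).
  apply Rle_trans with (2 := energy_nonincreasing t y ltac:(lra) ltac:(lra)).
  apply Rle_trans with (2 := energy_ge_of_deviation y ltac:(lra) ltac:(lra)).
  rewrite Ey. apply Rmult_le_compat_r; [assumption | nra].
Qed.

Lemma prolate_root_Derive_sqr_ge_energy (t : R) :
  0 <= t < 1 -> f t = 0 -> energy c chi f 0 <= Derive f t ^ 2.
Proof.
  intros Ht Hroot. assert (Hc2 := pow2_ge_0 c).
  assert (Hp : 0 < 1 - t ^ 2) by nra. assert (Hq := potential_ge t).
  assert (Hqt := potential_pos t ltac:(lra)).
  assert (Hamp := amplitude_nondecreasing 0 t ltac:(lra) ltac:(lra)).
  apply Rmult_le_compat_l with (r := chi) in Hamp; [|lra].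
  replace (chi * amplitude c chi f 0) with (energy c chi f 0) in Hamp
    by (unfold energy, amplitude, potential; field; lra).
  apply Rle_trans with (1 := Hamp). unfold amplitude. rewrite Hroot.
  replace (chi * (0 ^ 2 + flux f t ^ 2 / ((1 - t ^ 2) * potential c chi t)))
    with (chi * (1 - t ^ 2) / potential c chi t * Derive f t ^ 2)
    by (unfold flux; field; lra).
  rewrite <- (Rmult_1_l (Derive f t ^ 2)) at 2.
  apply Rmult_le_compat_r; [apply pow2_ge_0|].
  apply Rmult_le_reg_r with (potential c chi t); [assumption|].
  field_simplify; lra.
Qed.

(* Multiplying the bounds for [flux f t] and [Derive f t] brings in
   [f 1 ^ 2 * energy 0], which the mass controls. *)
Lemma prolate_nonneg_root_Derive_ge (t : R) :
  0 <= t < 1 -> f t = 0 ->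
  4 * chi * mass f 1 ^ 2 <= 27 * ((1 - t ^ 2) * Derive f t ^ 2) ^ 2.
Proof.
  intros Ht Hroot. assert (Hmass := mass_sqr_le_endpoint_energy).
  assert (Hprod : 8 / 27 * f 1 ^ 2 * energy c chi f 0 <= flux f t ^ 2 * Derive f t ^ 2).
  { apply Rmult_le_compat; [| now apply energy_nonneg; lra
      | now apply prolate_root_flux_ge | now apply prolate_root_Derive_sqr_ge_energy].
    assert (Hf1 := pow2_ge_0 (f 1)). lra. }
  replace (((1 - t ^ 2) * Derive f t ^ 2) ^ 2) with (flux f t ^ 2 * Derive f t ^ 2)
    by (unfold flux; ring).
  lra.
Qed.

Lemma prolate_root_Derive_ge (s t : R) :
  parity s f -> -1 < t < 1 -> f t = 0 ->
  4 * chi * mass f 1 ^ 2 <= 27 * ((1 - t ^ 2) * Derive f t ^ 2) ^ 2.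
Proof.
  intros Hs Ht Hroot. destruct (Rle_lt_dec 0 t) as [Hpos|Hneg].
  - apply prolate_nonneg_root_Derive_ge; [lra | assumption].
  - rewrite <- (parity_Derive_sqr_opp s f t Hs).
    + replace (t ^ 2) with ((- t) ^ 2) by ring.
      apply prolate_nonneg_root_Derive_ge; [lra|]. rewrite (proj2 Hs), Hroot. ring.
    + eexists. apply prolate_is_derive. lra.
Qed.

(** * Zeros in short intervals *)

Lemma is_derive_liouville (x : R) :
  -1 < x < 1 ->
  is_derive (fun y => sqrt (1 - y ^ 2) * f y) x
    ((flux f x - x * f x) / sqrt (1 - x ^ 2)).
Proof.
  intros Hx. assert (Hp : 0 < 1 - x ^ 2) by nra. assert (Hr := sqrt_lt_R0 _ Hp).
  assert (Hr2 := pow2_sqrt _ (Rlt_le _ _ Hp)). assert (Hdf := prolate_is_derive x Hx).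
  auto_derive; replace (1 + - (x * (x * 1))) with (1 - x ^ 2) by ring.
  - repeat split; [lra | eexists; eassumption].
  - change (fun y => f y) with f. unfold flux.
    set (r := sqrt (1 - x ^ 2)) in *. rewrite <- Hr2. field. lra.
Qed.

Lemma is_derive_liouville_derivative (x : R) :
  -1 < x < 1 ->
  is_derive (fun y => (flux f y - y * f y) / sqrt (1 - y ^ 2)) x
    (- (((potential c chi x + 1) / (1 - x ^ 2) + x ^ 2 / (1 - x ^ 2) ^ 2)
      * (sqrt (1 - x ^ 2) * f x))).
Proof.
  intros Hx. assert (Hp : 0 < 1 - x ^ 2) by nra. assert (Hr := sqrt_lt_R0 _ Hp).
  assert (Hr2 := pow2_sqrt _ (Rlt_le _ _ Hp)). assert (Hdf := prolate_is_derive x Hx).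
  assert (Hdflux := is_derive_flux x Hx).
  auto_derive; replace (1 + - (x * (x * 1))) with (1 - x ^ 2) by ring.
  - repeat split; try (eexists; eassumption); lra.
  - change (fun y => f y) with f. change (fun y => flux f y) with (flux f).
    rewrite (is_derive_unique _ _ _ Hdflux). unfold flux.
    set (r := sqrt (1 - x ^ 2)) in *. rewrite <- Hr2. field. lra.
Qed.

Lemma prolate_zero_in_window (k a : R) :
  0 < k -> k ^ 2 < chi + 1 -> -1 < a -> a + PI / k < 1 ->
  exists x, a < x < a + PI / k /\ f x = 0.
Proof.
  intros Hk Hkchi Ha Hb.
  assert (Hp : forall x, -1 < x < 1 -> 0 < 1 - x ^ 2) by (intros; nra).
  destruct (sturm_zero (fun x => sqrt (1 - x ^ 2) * f x)
    (fun x => (flux f x - x * f x) / sqrt (1 - x ^ 2))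
    (fun x => (potential c chi x + 1) / (1 - x ^ 2) + x ^ 2 / (1 - x ^ 2) ^ 2) k a Hk)
    as [x [Hx E]].
  - intros x Hx. apply is_derive_liouville. lra.
  - intros x Hx. apply is_derive_liouville_derivative. lra.
  - intros x Hx. specialize (Hp x ltac:(lra)). assert (Hq := potential_ge x).
    assert (Hx2 := pow2_ge_0 x).
    assert (0 <= x ^ 2 / (1 - x ^ 2) ^ 2) by (apply Rle_mult_inv_pos; nra).
    assert (chi + 1 <= (potential c chi x + 1) / (1 - x ^ 2)).
    { apply Rmult_le_reg_r with (1 - x ^ 2); [assumption|].
      field_simplify; lra. }
    lra.
  - exists x. split; [assumption|]. apply Rmult_integral in E.
    destruct E as [E|E]; [|assumption].
    assert (Hr := sqrt_lt_R0 _ (Hp x ltac:(lra))). lra.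
Qed.

Lemma prolate_chi_le_root_count (n : nat) (t : nat -> R) :
  (forall j, (1 <= j < n)%nat -> t j < t (S j)) ->
  (forall x, -1 < x < 1 -> f x = 0 -> exists j, (1 <= j <= n)%nat /\ x = t j) ->
  chi + 1 <= (PI / 2 * (INR n + 1)) ^ 2.
Proof.
  intros Hinc Hall. apply Rnot_lt_le; intros Hlt. assert (Hc2 := pow2_ge_0 c).
  assert (Hn := pos_INR n). assert (Hpi := PI_RGT_0).
  set (X := PI / 2 * (INR n + 1)) in *.
  assert (HX0 : 0 < X) by (unfold X; nra).
  set (k := (X + sqrt (chi + 1)) / 2).
  assert (Hs2 := pow2_sqrt (chi + 1) ltac:(lra)).
  assert (Hs := sqrt_pos (chi + 1)). set (s := sqrt (chi + 1)) in *.
  assert (HXs : X < s) by nra.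
  assert (Hk : X < k) by (unfold k; lra).
  assert (Hkchi : k ^ 2 < chi + 1) by (unfold k; nra).
  assert (Hlen : 1 - (-1) <= (INR n + 1) * (PI / k)).
  { apply length_le_of_hit_windows with t; [apply Rdiv_lt_0_compat; lra | assumption |].
    intros a Ha Hb.
    destruct (prolate_zero_in_window k a ltac:(lra) Hkchi Ha Hb) as [x [Hx E]].
    destruct (Hall x ltac:(lra) E) as [j [Hj ->]]. now exists j. }
  apply Rmult_le_compat_r with (r := k) in Hlen; [|lra].
  replace ((INR n + 1) * (PI / k) * k) with (2 * X) in Hlen by (unfold X; field; lra).
  lra.
Qed.

End PositivePotential.

(** * Weighted supremum bound *)

(* For [f] even or odd, this is the integral from [0] to [x] of
   [(2 k (1 + k) - potential) f ^ 2 + (1 - x ^ 2) f' ^ 2]. *)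
Definition sup_majorant (k x : R) : R :=
  2 * k * (1 + k) * mass f x + flux f x * f x.

Lemma is_derive_sup_majorant (k x : R) :
  -1 < x < 1 ->
  is_derive (sup_majorant k) x
    ((2 * k * (1 + k) - potential c chi x) * f x ^ 2 + (1 - x ^ 2) * Derive f x ^ 2).
Proof.
  intros Hx. assert (Hdmass := is_derive_mass x Hx).
  assert (Hdf := prolate_is_derive x Hx). assert (Hdflux := is_derive_flux x Hx).
  unfold sup_majorant. auto_derive; [repeat split; eexists; eassumption|].
  change (fun y => f y) with f. change (fun y => flux f y) with (flux f).
  change (fun y => mass f y) with (mass f).
  rewrite (is_derive_unique _ _ _ Hdmass), (is_derive_unique _ _ _ Hdflux).
  unfold flux. ring.
Qed.

Lemma sup_majorant_nonneg (s k x : R) :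
  parity s f -> 0 < k -> chi <= k ^ 2 -> 0 <= x < 1 -> 0 <= sup_majorant k x.
Proof.
  intros Hs Hk Hchi Hx.
  assert (Hmaj0 : sup_majorant k 0 = 0).
  { unfold sup_majorant, flux. rewrite mass_0.
    rewrite (Rmult_assoc (1 - 0 ^ 2)), (parity_mul_Derive_0 s f Hs); [ring|].
    eexists. apply prolate_is_derive. lra. }
  rewrite <- Hmaj0. eapply nonneg_derive_le; [apply Hx| |]; intros y Hy.
  - apply is_derive_sup_majorant. lra.
  - assert (Hq : potential c chi y <= k ^ 2).
    { unfold potential.
      assert (0 <= c ^ 2 * y ^ 2) by (apply Rmult_le_pos; apply pow2_ge_0). lra. }
    apply Rplus_le_le_0_compat; apply Rmult_le_pos; try apply pow2_ge_0; nra.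
Qed.

(* The derivative is at least
   [(1 - x ^ 2) (k f + f') ^ 2 + k ((2 - 2 x) + k x ^ 2) f ^ 2]. *)
Lemma sup_majorant_add_nondecreasing (k x y : R) :
  0 < k -> chi <= k ^ 2 -> 0 <= x <= y -> y < 1 ->
  sup_majorant k x + k * ((1 - x ^ 2) * f x ^ 2)
    <= sup_majorant k y + k * ((1 - y ^ 2) * f y ^ 2).
Proof.
  intros Hk Hchi Hxy Hy.
  apply (nonneg_derive_le (fun z => sup_majorant k z + k * ((1 - z ^ 2) * f z ^ 2))
    (fun z => (2 * k * (1 + k) - potential c chi z) * f z ^ 2
      + (1 - z ^ 2) * Derive f z ^ 2
      + k * (- (2 * z) * f z ^ 2 + (1 - z ^ 2) * (2 * f z * Derive f z))));
    [lra| |]; intros z Hz.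
  - apply (is_derive_plus (sup_majorant k)); [apply is_derive_sup_majorant; lra|].
    assert (Hdf := prolate_is_derive z ltac:(lra)).
    auto_derive; [repeat split; eexists; eassumption|].
    change (fun y => f y) with f. ring.
  - assert (Hf2 := pow2_ge_0 (f z)).
    assert (Hsqr : 0 <= (1 - z ^ 2) * (k * f z + Derive f z) ^ 2)
      by (apply Rmult_le_pos; [nra | apply pow2_ge_0]).
    assert (Hrest : 0 <= (k ^ 2 - chi + c ^ 2 * z ^ 2 + k * (2 - 2 * z) + k ^ 2 * z ^ 2)
      * f z ^ 2).
    { apply Rmult_le_pos; [|assumption].
      assert (0 <= c ^ 2 * z ^ 2) by (apply Rmult_le_pos; apply pow2_ge_0).
      assert (0 <= k ^ 2 * z ^ 2) by (apply Rmult_le_pos; apply pow2_ge_0).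
      nra. }
    unfold potential. nra.
Qed.

Lemma sup_majorant_near_1 (k : R) :
  0 < k ->
  exists C, forall y, 0 <= y < 1 ->
    sup_majorant k y + k * ((1 - y ^ 2) * f y ^ 2)
      <= 2 * k * (1 + k) * mass f 1 + C * (1 - y).
Proof.
  intros Hk. destruct prolate_bounded as [B HB].
  destruct prolate_flux_vanishes as [C HC].
  exists (C * B + 2 * k * B ^ 2). intros y Hy.
  assert (Hmass := mass_nondecreasing y ltac:(lra)).
  assert (Hflux : flux f y * f y <= C * (1 - y) * B).
  { apply Rle_trans with (1 := Rle_abs _). rewrite Rabs_mult.
    apply Rmult_le_compat; try apply Rabs_pos; [apply HC | apply HB]; lra. }
  assert (Hf2 : (1 - y ^ 2) * f y ^ 2 <= 2 * (1 - y) * B ^ 2).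
  { apply Rmult_le_compat; [nra | apply pow2_ge_0 | nra | apply pow_maj_Rabs, HB; lra]. }
  unfold sup_majorant.
  apply Rmult_le_compat_l with (r := k) in Hf2; [|lra].
  apply Rmult_le_compat_l with (r := 2 * k * (1 + k)) in Hmass; [|nra].
  lra.
Qed.

Lemma prolate_nonneg_weighted_sqr_le (s k x : R) :
  parity s f -> 0 < k -> chi <= k ^ 2 -> 0 <= x < 1 ->
  (1 - x ^ 2) * f x ^ 2 <= 2 * (1 + k) * mass f 1.
Proof.
  intros Hs Hk Hchi Hx. destruct (sup_majorant_near_1 k Hk) as [C HC].
  assert (Hpos := sup_majorant_nonneg s k x Hs Hk Hchi Hx).
  apply Rmult_le_reg_l with k; [assumption|].
  set (g := fun y => 2 * k * (1 + k) * mass f 1 + C * (1 - y)).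
  replace (k * (2 * (1 + k) * mass f 1)) with (g 1) by (unfold g; ring).
  apply continuous_ge_of_interior with x 1; [lra | lra | |].
  - apply (ex_derive_continuous g). unfold g. auto_derive. easy.
  - intros y Hy. apply Rle_trans with (2 := HC y ltac:(lra)).
    assert (Hgrow := sup_majorant_add_nondecreasing k x y Hk Hchi ltac:(lra) ltac:(lra)).
    lra.
Qed.

Lemma prolate_weighted_sqr_le (s k x : R) :
  parity s f -> 0 < k -> chi <= k ^ 2 -> -1 < x < 1 ->
  (1 - x ^ 2) * f x ^ 2 <= 2 * (1 + k) * mass f 1.
Proof.
  intros Hs Hk Hchi Hx. destruct (Rle_lt_dec 0 x) as [Hpos|Hneg].
  - now apply (prolate_nonneg_weighted_sqr_le s); try lra.
  - rewrite <- (parity_sqr_opp s f x Hs).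
    replace (x ^ 2) with ((- x) ^ 2) by ring.
    apply (prolate_nonneg_weighted_sqr_le s); try assumption; lra.
Qed.

End Prolate.

(** * Oscillatory integrals and complex sums *)

Lemma add_cos_sin_sqr_le (A B x : R) :
  (A * cos x + B * sin x) ^ 2 <= A ^ 2 + B ^ 2.
Proof.
  assert (Hcs := sin2_cos2 x). unfold Rsqr in Hcs.
  assert (Horth := pow2_ge_0 (A * sin x - B * cos x)).
  replace (A ^ 2 + B ^ 2)
    with ((A ^ 2 + B ^ 2) * (sin x * sin x + cos x * cos x)) by (rewrite Hcs; ring).
  nra.
Qed.

(* With [g = A cos w + B sin w] for [A] and [B] the two integrals, the integral
   of [f g] is [A ^ 2 + B ^ 2], and [2 L f g <= (L f) ^ 2 + g ^ 2] for [L = b - a]. *)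
Lemma RInt_cos_sin_sqr_le (f w : R -> R) (a b : R) :
  a < b ->
  (forall x, a <= x <= b -> continuous f x) ->
  (forall x, a <= x <= b -> continuous w x) ->
  RInt (fun x => f x * cos (w x)) a b ^ 2 + RInt (fun x => f x * sin (w x)) a b ^ 2
    <= (b - a) * RInt (fun x => f x ^ 2) a b.
Proof.
  intros Hab Hf Hw.
  assert (Hint : forall g : R -> R, (forall x, a <= x <= b -> continuous g x) ->
    is_RInt g a b (RInt g a b)).
  { intros g Hg. apply (RInt_correct g), (ex_RInt_continuous g). intros z Hz.
    rewrite Rmin_left, Rmax_right in Hz by lra. now apply Hg. }
  assert (HA : is_RInt (fun x => f x * cos (w x)) a b
    (RInt (fun x => f x * cos (w x)) a b)).
  { apply Hint. intros x Hx. apply (continuous_mult f (fun x => cos (w x)));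
      [now apply Hf | apply continuous_comp; [now apply Hw | apply continuous_cos]]. }
  assert (HB : is_RInt (fun x => f x * sin (w x)) a b
    (RInt (fun x => f x * sin (w x)) a b)).
  { apply Hint. intros x Hx. apply (continuous_mult f (fun x => sin (w x)));
      [now apply Hf | apply continuous_comp; [now apply Hw | apply continuous_sin]]. }
  assert (HM : is_RInt (fun x => f x ^ 2) a b (RInt (fun x => f x ^ 2) a b))
    by (apply Hint; intros x Hx; now apply continuous_sqr, Hf).
  set (A := RInt (fun x => f x * cos (w x)) a b) in *.
  set (B := RInt (fun x => f x * sin (w x)) a b) in *.
  set (M := RInt (fun x => f x ^ 2) a b) in *. set (L := b - a).
  assert (HL : 0 < L) by (unfold L; lra).
  assert (Hle : 2 * L * A * A + 2 * L * B * B <= L ^ 2 * M + (b - a) * (A ^ 2 + B ^ 2)).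
  { refine (is_RInt_le _ _ a b _ _ _
      (is_RInt_plus _ _ _ _ _ _
        (is_RInt_scal _ _ _ (2 * L * A) _ HA) (is_RInt_scal _ _ _ (2 * L * B) _ HB))
      (is_RInt_plus _ _ _ _ _ _
        (is_RInt_scal _ _ _ (L ^ 2) _ HM) (is_RInt_const a b (A ^ 2 + B ^ 2))) _);
      [lra|].
    intros x _. unfold plus, scal; simpl; unfold mult; simpl.
    assert (Hg := add_cos_sin_sqr_le A B (w x)).
    assert (Hsqr := pow2_ge_0 (L * f x - (A * cos (w x) + B * sin (w x)))).
    lra. }
  fold L in Hle. apply Rmult_le_reg_l with L; [assumption | lra].
Qed.

Lemma Cmod_sum_n_m_le (x y : nat -> R) (D : R) (n : nat) :
  (forall j, (1 <= j <= n)%nat -> Cmod (x j, y j) <= D) ->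
  Cmod (sum_n_m x 1 n, sum_n_m y 1 n) <= INR n * D.
Proof.
  induction n as [|n IH]; intros Hbound.
  - rewrite !sum_n_m_zero by lia. change (Cmod 0 <= 0 * D). rewrite Cmod_0. lra.
  - rewrite !sum_n_Sm by lia. rewrite S_INR.
    apply Rle_trans with (Cmod (sum_n_m x 1 n, sum_n_m y 1 n) + Cmod (x (S n), y (S n)));
      [exact (Cmod_triangle (_, _) (_, _))|].
    assert (Hn := Hbound (S n) ltac:(lia)).
    specialize (IH ltac:(intros; apply Hbound; lia)). lra.
Qed.

Lemma Cmod_scale (r u v : R) : Cmod (r * u, r * v) = Rabs r * Cmod (u, v).
Proof. rewrite <- Cmod_R, <- Cmod_mult. f_equal. unfold Cmult; simpl. f_equal; ring. Qed.

(** * Prolate spheroidal wave functions *)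

Section PSWF.

Context {c : R} {lam_re lam_im : nat -> R} {psi : nat -> R -> R} {chi : nat -> R}.
Hypothesis Hsys : PSWF_system c lam_re lam_im psi chi.

Lemma pswf_prolate (n : nat) : prolate c (chi n) (psi n).
Proof.
  constructor; [apply (pswf_cont _ _ _ _ _ Hsys) | apply (pswf_ode _ _ _ _ _ Hsys)].
Qed.

Lemma pswf_has_parity (n : nat) : parity ((-1) ^ n) (psi n).
Proof.
  split; [|apply (pswf_parity _ _ _ _ _ Hsys)].
  now rewrite <- pow_mult, Nat.mul_comm, pow_1_even.
Qed.

Lemma pswf_mass (n : nat) : mass (psi n) 1 = 1 / 2.
Proof.
  assert (Hnorm := pswf_norm _ _ _ _ _ Hsys n).
  change (-1) with (- (1)) in Hnorm. rewrite RInt_even in Hnorm.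
  - unfold mass. lra.
  - intros x. apply (parity_sqr_opp _ _ _ (pswf_has_parity n)).
  - apply (prolate_sqr_integrable (pswf_prolate n)); lra.
  - apply (prolate_sqr_integrable (pswf_prolate n)); lra.
Qed.

Lemma pswf_chi_le (m n : nat) : (m <= n)%nat -> chi m <= chi n.
Proof.
  intros Hmn. induction Hmn as [|n Hmn IH]; [lra|].
  assert (Hincr := pswf_chi_incr _ _ _ _ _ Hsys n). lra.
Qed.

Lemma Psi1_Cmod_le (n : nat) (t : R) :
  Cmod (Psi1_re c (psi n) t, Psi1_im c (psi n) t) <= sqrt (1 / 2).
Proof.
  assert (Hint : RInt (fun x => psi n x * cos (c * x * t)) 0 1 ^ 2
    + RInt (fun x => psi n x * sin (c * x * t)) 0 1 ^ 2 <= (1 - 0) * mass (psi n) 1).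
  { apply (RInt_cos_sin_sqr_le (psi n) (fun x => c * x * t)); [lra| |].
    - intros x Hx. apply (pswf_cont _ _ _ _ _ Hsys). lra.
    - intros x _. apply (ex_derive_continuous (fun x => c * x * t)). auto_derive. easy. }
  rewrite pswf_mass in Hint.
  apply sqrt_le_1_alt. unfold Psi1_re, Psi1_im; simpl fst; simpl snd. lra.
Qed.

Lemma pswf_sqrt_chi_le (n : nat) (t : nat -> R) :
  (1 <= n)%nat -> c ^ 2 < chi n ->
  (forall j, (1 <= j < n)%nat -> t j < t (S j)) ->
  (forall x, -1 < x < 1 -> psi n x = 0 -> exists j, (1 <= j <= n)%nat /\ x = t j) ->
  sqrt (chi n) <= 3 * INR n.
Proof.
  intros Hn Hchi Hinc Hall. assert (Hn1 := le_INR 1 n Hn). simpl in Hn1.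
  assert (Hroots := prolate_chi_le_root_count (pswf_prolate n) Hchi n t Hinc Hall).
  assert (HX : (PI / 2 * (INR n + 1)) ^ 2 <= (11 / 7 * (INR n + 1)) ^ 2).
  { assert (Hpi := PI_le_22_7). assert (Hpi0 := PI_RGT_0).
    apply pow_incr. split; [nra|]. apply Rmult_le_compat_r; lra. }
  rewrite <- (sqrt_pow2 (3 * INR n)) by lra. apply sqrt_le_1_alt. nra.
Qed.

Lemma pswf_weighted_sqr_le (m n : nat) (x : R) :
  (m <= n)%nat -> -1 < x < 1 ->
  (1 - x ^ 2) * psi m x ^ 2 <= 1 + sqrt (chi n).
Proof.
  intros Hmn Hx. assert (Hchi0 := pswf_chi_pos _ _ _ _ _ Hsys n).
  assert (Hchim := pswf_chi_le m n Hmn).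
  rewrite <- (pow2_sqrt (chi n)) in Hchim by lra.
  assert (Hsup := prolate_weighted_sqr_le (pswf_prolate m) _ (sqrt (chi n)) x
    (pswf_has_parity m) (sqrt_lt_R0 _ Hchi0) Hchim Hx).
  rewrite pswf_mass in Hsup. lra.
Qed.

Lemma pswf_root_Derive_ge (n : nat) (x : R) :
  c ^ 2 < chi n -> -1 < x < 1 -> psi n x = 0 ->
  3 * sqrt (chi n) <= 16 * ((1 - x ^ 2) * Derive (psi n) x ^ 2).
Proof.
  intros Hchi Hx Hroot. assert (Hchi0 := pswf_chi_pos _ _ _ _ _ Hsys n).
  assert (Hder := prolate_root_Derive_ge (pswf_prolate n) Hchi _ x
    (pswf_has_parity n) Hx Hroot).
  rewrite pswf_mass, <- (pow2_sqrt (chi n)) in Hder by lra.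
  assert (Hs := sqrt_pos (chi n)).
  assert (Hz : 0 <= (1 - x ^ 2) * Derive (psi n) x ^ 2)
    by (apply Rmult_le_pos; [nra | apply pow2_ge_0]).
  set (z := (1 - x ^ 2) * Derive (psi n) x ^ 2) in *. nra.
Qed.

Lemma pswf_root_ratio_le (n m : nat) (x : R) :
  0 < c -> (m < n)%nat -> c ^ 2 < chi n -> sqrt (chi n) <= 3 * INR n ->
  -1 < x < 1 -> psi n x = 0 ->
  Rabs (psi m x / Derive (psi n) x) <= 8 * INR n / c.
Proof.
  intros Hc Hmn Hchi Hs3 Hx Hroot.
  assert (Hn := le_INR 1 n ltac:(lia)). simpl in Hn.
  assert (Hchi0 := pswf_chi_pos _ _ _ _ _ Hsys n).
  assert (Hs0 := sqrt_lt_R0 _ Hchi0).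
  assert (Hs2 := pow2_sqrt _ (Rlt_le _ _ Hchi0)).
  assert (Hsup := pswf_weighted_sqr_le m n x ltac:(lia) Hx).
  assert (Hder := pswf_root_Derive_ge n x Hchi Hx Hroot).
  set (s := sqrt (chi n)) in *. set (d := Derive (psi n) x) in *.
  assert (Hp : 0 < 1 - x ^ 2) by nra.
  assert (Hd : d <> 0) by (intros E; rewrite E in Hder; lra).
  assert (Hsn : c ^ 2 * (1 + s) <= 12 * INR n ^ 2 * s).
  { assert (s * (1 + s) <= 12 * INR n ^ 2) by nra.
    apply Rle_trans with (s * (1 + s) * s); [nra|].
    apply Rmult_le_compat_r; lra. }
  assert (Hsqr : (c * psi m x) ^ 2 <= (8 * INR n * d) ^ 2).
  { apply Rmult_le_reg_l with (1 - x ^ 2); [assumption|].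
    apply Rle_trans with (c ^ 2 * (1 + s)).
    - replace ((1 - x ^ 2) * (c * psi m x) ^ 2)
        with (c ^ 2 * ((1 - x ^ 2) * psi m x ^ 2)) by ring.
      apply Rmult_le_compat_l; [apply pow2_ge_0 | lra].
    - apply Rle_trans with (1 := Hsn).
      replace ((1 - x ^ 2) * (8 * INR n * d) ^ 2)
        with (4 * INR n ^ 2 * (16 * ((1 - x ^ 2) * d ^ 2))) by ring.
      assert (Hn2 := pow2_ge_0 (INR n)). nra. }
  rewrite <- !Rsqr_pow2 in Hsqr. apply Rsqr_le_abs_0 in Hsqr.
  rewrite !Rabs_mult, (Rabs_pos_eq c), (Rabs_pos_eq 8), (Rabs_pos_eq (INR n)) in Hsqr
    by lra.
  assert (Hd0 := Rabs_pos_lt _ Hd).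
  rewrite Rabs_div by assumption.
  apply Rmult_le_reg_r with (c * Rabs d); [now apply Rmult_lt_0_compat|].
  field_simplify; lra.
Qed.

End PSWF.

Theorem theorem61 (c : R) (lam_re lam_im : nat -> R) (psi : nat -> R -> R)
    (chi : nat -> R) (n m : nat) (t : nat -> R) :
  0 < c ->
  PSWF_system c lam_re lam_im psi chi ->
  (m < n)%nat ->
  chi n > c ^ 2 ->
  (forall j, (1 <= j < n)%nat -> t j < t (S j)) ->
  (forall j, (1 <= j <= n)%nat -> -1 < t j < 1 /\ psi n (t j) = 0) ->
  (forall x, -1 < x < 1 -> psi n x = 0 -> exists j, (1 <= j <= n)%nat /\ x = t j) ->
  c * sqrt (P_re c psi n m t ^ 2 + P_im c psi n m t ^ 2) <= sqrt 32 * INR n ^ 2.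
Proof.
  intros Hc Hsys Hmn Hchi Hinc Hroots Hall.
  assert (Hs := pswf_sqrt_chi_le Hsys n t ltac:(lia) Hchi Hinc Hall).
  assert (Hsum : Cmod (P_re c psi n m t, P_im c psi n m t)
    <= INR n * (8 * INR n / c * sqrt (1 / 2))).
  { apply Cmod_sum_n_m_le. intros j Hj. destruct (Hroots j Hj) as [Htj Hroot].
    rewrite Cmod_scale. apply Rmult_le_compat; [apply Rabs_pos | apply Cmod_ge_0 | |].
    - now apply (pswf_root_ratio_le Hsys n m); try lia.
    - apply (Psi1_Cmod_le Hsys). }
  assert (H32 : sqrt 32 = 8 * sqrt (1 / 2)).
  { rewrite <- (sqrt_pow2 8) by lra. rewrite <- sqrt_mult by lra. f_equal. field. }
  apply Rle_trans with (c * (INR n * (8 * INR n / c * sqrt (1 / 2)))).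
  - apply Rmult_le_compat_l; [lra | exact Hsum].
  - apply Req_le. rewrite H32. field. lra.
Qed.
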